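(* Let $k \geq 2$ be an integer, let $\ell = a_0 x_0 + a_1 x_1 + a_2 x_2 \in \mathbb{C}[x_0,x_1,x_2]$ be a nonzero linear form, and for $\lambda \in \mathbb{C}\setminus\{0\}$ let $f = f_\lambda = x_0^k x_1^k x_2^k + \lambda \ell^{3k}$. Then: \begin{itemize} \item If $a_0a_1a_2 \neq 0$, there is a unique $\lambda_0 \in \mathbb{C}\setminus\{0\}$ such that $\mathrm{R}(f_\lambda) = (k+1)^2 - 1$ if $\lambda = \lambda_0$ and $\mathrm{R}(f_\lambda) = (k+1)^2$ if $\lambda \neq \lambda_0$; moreover, for every $\lambda \neq 0$, $f_\lambda$ has a unique minimal Waring decomposition. \item If $a_0a_1a_2 = 0$, then $\mathrm{R}(f_\lambda) = (k+1)^2 + 1$ for every $\lambda \neq 0$. \end{itemize}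
   Context: For a homogeneous polynomial $f \in \mathbb{C}[x_0,\dots,x_n]$ of degree $d$, the Waring rank $\mathrm{R}(f)$ is the smallest $r$ such that $f = \ell_1^d + \cdots + \ell_r^d$ for some linear forms $\ell_1,\dots,\ell_r$. A Waring decomposition of $f$ is a finite set of points $\mathbb{X} = \{[\ell_1],\dots,[\ell_r]\}$ in the projective space of linear forms such that $f$ is a linear combination of $\ell_1^d,\dots,\ell_r^d$. It is minimal if $\#\mathbb{X} = \mathrm{R}(f)$. *)

(* Defs.v *)
From HB Require Import structures.
From mathcomp Require Export all_boot all_order all_algebra.
From mathcomp Require Export complex mpoly finmap reals.

Set Implicit Arguments.
Unset Strict Implicit.
Unset Printing Implicit Defensive.

Import GRing.Theory.
Local Open Scope ring_scope.

Section Waring.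
Variables (C : fieldType) (n : nat).

Definition linear_form := dhomog n.+1 C 1.

Definition sum_of_powers (d : nat) (f : {mpoly C[n.+1]}) (r : nat) : Prop :=
  exists l : 'I_r -> linear_form, f = \sum_(i < r) (l i : {mpoly C[n.+1]}) ^+ d.

(* The relation "R(f) = r", for f homogeneous of degree d.  The degree is an
   explicit parameter; in particular a true instance asserts that f is a sum of
   finitely many d-th powers. *)
Definition waring_rank (d : nat) (f : {mpoly C[n.+1]}) (r : nat) : Prop :=
  sum_of_powers d f r /\ forall s, sum_of_powers d f s -> (r <= s)%N.

(* The points of the projective space of linear forms are the lines of the
   vector space of linear forms. *)
Definition proj_point := {L : {vspace linear_form} | \dim L == 1%N}.

(* A form l with [l] = p.  Another choice of l only rescales l ^+ d by a nonzero
   constant, so waring_decomposition does not depend on it. *)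
Definition repr_form (p : proj_point) : {mpoly C[n.+1]} := vpick (val p).

Definition waring_decomposition (d : nat) (f : {mpoly C[n.+1]})
    (X : {fset proj_point}) : Prop :=
  exists c : proj_point -> C, f = \sum_(p <- X) c p *: repr_form p ^+ d.

Definition minimal_waring_decomposition (d : nat) (f : {mpoly C[n.+1]})
    (X : {fset proj_point}) : Prop :=
  waring_decomposition d f X /\ waring_rank d f #|` X|.

End Waring.

Definition ternary_linear (C : fieldType) (a0 a1 a2 : C) : {mpoly C[3]} :=
  a0 *: 'X_0 + a1 *: 'X_1 + a2 *: 'X_2.

Definition f_ (C : fieldType) (k : nat) (a0 a1 a2 lambda : C) : {mpoly C[3]} :=
  'X_0 ^+ k * 'X_1 ^+ k * 'X_2 ^+ k
  + lambda *: ternary_linear a0 a1 a2 ^+ (3 * k).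

(* Main.v *)
(* Let N = (k+1)^2 and M = (x0 x1 x2)^k.  A decomposition of M of degree 3k at points
   p with coefficients c_p amounts to the moment identities
     sum_p c_p p0^e p1^a p2^b = mu [a = b = k]   (e + a + b = 3k).
   In the chart p0 = 1, with coordinates (u, v), they make the functions u^a v^b
   (a, b <= k) linearly independent on the points off the line p0 = 0, so there are at
   least N of those.  If there are at most N + 1 points in all and every c_p is nonzero,
   then no point lies on that line, and u^(k+1) and v^(k+1) are constant on the points:
   hence there are exactly N of them, they have nonzero coordinates, and they are
   determined by any one of them.

   A decomposition of f = M + lambda l^(3k) at r <= N points gives one of M at r or r + 1
   points, which must then contain [l]; therefore a0 a1 a2 <> 0, and this decomposition
   of M is the unique minimal one through [l].  Its coefficient at [l] is cancelled by
   lambda l^(3k) for exactly one lambda. *)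
Require Import Defs.
From mathcomp Require Import ring zify.
From mathcomp Require Import cyclic separable cyclotomic.
Set Implicit Arguments.
Unset Strict Implicit.
Unset Printing Implicit Defensive.
Import GRing.Theory Num.Theory.
Local Open Scope fset_scope.
Local Open Scope ring_scope.

(** * Linear algebra of independent functions on a finite set *)

Section IndependentFunctions.
Variables (F : fieldType) (B I : finType) (f : B -> I -> F).

Definition independent :=
  forall g : B -> F, (forall i, \sum_b g b * f b i = 0) -> forall b, g b = 0.

Let E : 'M[F]_(#|B|, #|I|) := \matrix_(b, i) f (enum_val b) (enum_val i).

Let row_mulE (x : 'rV_#|B|) i :
  (x *m E) 0 (enum_rank i) = \sum_b x 0 (enum_rank b) * f b i.
Proof.
rewrite mxE (reindex (@enum_rank B)); last exact/onW_bij/enum_rank_bij.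
by apply: eq_bigr => b _; rewrite mxE !enum_rankK.
Qed.

Let independent_row_free : independent -> row_free E.
Proof.
move=> f_indep; rewrite -kermx_eq0; apply/rowV0P => x /sub_kermxP xE0.
apply/rowP => b; rewrite -(enum_valK b) mxE.
apply: (f_indep (fun c => x 0 (enum_rank c))) => i.
by rewrite -row_mulE xE0 mxE.
Qed.

Lemma independent_leq : independent -> (#|B| <= #|I|)%N.
Proof. by move/independent_row_free/eqP => <-; exact: rank_leq_col. Qed.

(** With at most as many points as independent functions, the evaluation matrix [E] has full column
    rank, so its rows span all functions on the points. *)
Lemma independent_span (h : I -> F) : independent -> (#|I| <= #|B|)%N ->
  exists g : B -> F, forall i, h i = \sum_b g b * f b i.
Proof.
move=> f_indep leIB; have /eqP rE := independent_row_free f_indep.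
have full : row_full E.
  by apply/eqP/anti_leq; rewrite rank_leq_col rE.
have /submxP[x hx] := submx_full (\row_i h (enum_val i)) full.
exists (fun b => x 0 (enum_rank b)) => i.
by rewrite -row_mulE -hx mxE enum_rankK.
Qed.

(* The orthogonal complement of the span of f has dimension at most one. *)
Lemma independent_orthogonal (x y : I -> F) : independent -> (#|I| <= #|B|.+1)%N ->
  (forall b, \sum_i f b i * x i = 0) -> (forall b, \sum_i f b i * y i = 0) ->
  (exists i, x i != 0) -> exists c, forall i, y i = c * x i.
Proof.
move=> f_indep leIB x0 y0 [i0 xi0]; have /eqP rE := independent_row_free f_indep.
pose vec (z : I -> F) : 'rV_#|I| := \row_i z (enum_val i).
have in_ker z : (forall b, \sum_i f b i * z i = 0) -> (vec z <= kermx E^T)%MS.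
  move=> z0; apply/sub_kermxP/rowP => b; rewrite !mxE -[RHS](z0 (enum_val b)).
  rewrite (reindex (@enum_val _ I)); last exact/onW_bij/enum_val_bij.
  by apply: eq_bigr => i _; rewrite !mxE mulrC.
have x_ne0 : vec x != 0.
  by apply: contraNneq xi0 => /rowP/(_ (enum_rank i0)); rewrite !mxE enum_rankK => ->.
(* By rank-nullity the kernel has rank #|I| - #|B|, at most one, and it already contains the nonzero
   vector of x. *)
have ker_x : (kermx E^T <= vec x)%MS.
  rewrite -(geq_leqif (mxrank_leqif_sup (in_ker x x0))).
  by rewrite mxrank_ker mxrank_tr rE rank_rV x_ne0 leq_subLR addn1.
have /submxP[c hc] := submx_trans (in_ker y y0) ker_x.
exists (c 0 0) => i; move/rowP/(_ (enum_rank i)): hc.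
by rewrite !mxE big_ord1 !mxE enum_rankK.
Qed.

End IndependentFunctions.

(** * Moments of weighted points in an affine chart *)

Section AffinePoints.
Variables (C : fieldType) (I : finType) (k : nat) (mu : C).
Hypotheses (hk : (2 <= k)%N) (mu0 : mu != 0).

(* The moments of the monomial (x0 x1 x2)^k in the chart x0 = 1. *)
Definition moments (D : nat) (w u v : I -> C) :=
  forall a b, (a + b <= D)%N ->
    \sum_i w i * u i ^+ a * v i ^+ b = mu *+ ((a == k) && (b == k)).

Lemma moments_swap D w u v : moments D w u v -> moments D w v u.
Proof.
move=> mom a b; rewrite addnC => /mom; rewrite andbC => <-.
by apply: eq_bigr => i _; rewrite mulrAC.
Qed.

Local Notation box := ('I_k.+1 * 'I_k.+1)%type.

Definition box_monomial (u v : I -> C) (t : box) (i : I) := u i ^+ t.1 * v i ^+ t.2.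

Lemma card_box : #|{: box}| = (k.+1 ^ 2)%N.
Proof. by rewrite card_prod card_ord. Qed.

(* Multiply the relation by u^(k-a) v^(k-b) and take moments: the terms of degree
   above a + b vanish by induction, and among the others only (a, b) contributes. *)
Lemma relation_coef0 D w u v (e : C) (g : box -> C) (t : box) :
  (3 * k <= D.+1)%N -> moments D w u v ->
  (forall i, e * u i ^+ k.+1 + \sum_t g t * box_monomial u v t i = 0) ->
  e = 0 \/ (3 * k + 1 <= D + (t.1 + t.2))%N -> g t = 0.
Proof.
move=> hD mom rel.
have [n] := ubnP (2 * k - (t.1 + t.2)); elim: n t => // n IH t hn he.
have ha : (t.1 <= k)%N by rewrite -ltnS.
have hb : (t.2 <= k)%N by rewrite -ltnS.
have [a ea] : exists a, a = (k - t.1)%N by exists (k - t.1)%N.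
have [b eb] : exists b, b = (k - t.2)%N by exists (k - t.2)%N.
have : \sum_i w i * u i ^+ a * v i ^+ b *
    (e * u i ^+ k.+1 + \sum_t g t * box_monomial u v t i) = 0.
  by apply: big1 => i _; rewrite rel mulr0.
under eq_bigr => i _ do rewrite mulrDr mulr_sumr.
rewrite big_split /= exchange_big /=.
(* For nonzero e this is a moment whose exponent of u exceeds k, hence zero. Its degree is 3k + 1 -
   (t.1 + t.2), which the second alternative on t keeps within D. *)
have -> : \sum_i w i * u i ^+ a * v i ^+ b * (e * u i ^+ k.+1) = 0.
  case: he => [->|he]; first by apply: big1 => i _; rewrite mul0r mulr0.
  transitivity (e * \sum_i w i * u i ^+ (a + k.+1) * v i ^+ b).
    by rewrite mulr_sumr; apply: eq_bigr => i _; rewrite exprD; ring.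
  rewrite mom; last by lia.
  by rewrite (_ : (a + k.+1 == k)%N = false) ?mulr0 //; lia.
have term (s : box) : (a + b + (s.1 + s.2) <= D)%N ->
    \sum_i w i * u i ^+ a * v i ^+ b * (g s * box_monomial u v s i)
    = g s * (mu *+ ((a + s.1 == k)%N && (b + s.2 == k)%N)).
  move=> hs; rewrite -mom; last by lia.
  by rewrite mulr_sumr; apply: eq_bigr => i _; rewrite /box_monomial !exprD; ring.
have others (s : box) : s != t ->
    \sum_i w i * u i ^+ a * v i ^+ b * (g s * box_monomial u v s i) = 0.
  move=> st; have [lt|le] := ltnP (t.1 + t.2) (s.1 + s.2).
    rewrite big1 // => i _; rewrite (IH s) ?mul0r ?mulr0 //.
      by have := ltn_ord s.1; have := ltn_ord s.2; lia.
    by case: he => [|he]; [left | right; lia].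
  rewrite term; last by lia.
  rewrite (_ : (_ == k) && _ = false) ?mulr0 //.
  apply: contraNF st => /andP[/eqP e1 /eqP e2].
  by rewrite -pair_eqE; apply/andP; split; apply/eqP/val_inj => /=; lia.
rewrite add0r (bigD1 t) //= [X in _ + X](big1 _ _ _ others) addr0 term; last by lia.
rewrite (_ : (_ == k) && _); last by lia.
by move/eqP; rewrite mulf_eq0 (negPf mu0) orbF => /eqP.
Qed.

(** Moments up to degree 3k - 1 suffice; these are the ones that points on the line p0 = 0 do not
    affect. *)
Lemma box_independent D w u v : (3 * k <= D.+1)%N -> moments D w u v ->
  independent (box_monomial u v).
Proof.
move=> hD mom g rel t; apply: (relation_coef0 hD mom (e := 0)); last by left.
by move=> i; rewrite mul0r add0r.
Qed.

Lemma moments_card D w u v : (3 * k <= D.+1)%N -> moments D w u v ->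
  (k.+1 ^ 2 <= #|I|)%N.
Proof. by move=> hD /(box_independent hD)/independent_leq; rewrite card_box. Qed.

Lemma span_relation u v (g : box -> C) :
  (forall i, u i ^+ k.+1 = \sum_t g t * box_monomial u v t i) ->
  forall i, -1 * u i ^+ k.+1 + \sum_t g t * box_monomial u v t i = 0.
Proof. by move=> hg i; rewrite -hg mulN1r addNr. Qed.

(** For D = 3k the second alternative of [relation_coef0] covers every monomial of positive degree,
    so only the constant term of the relation survives. *)
Lemma box_span_power_const w u v (g : box -> C) : moments (3 * k) w u v ->
  (forall i, u i ^+ k.+1 = \sum_t g t * box_monomial u v t i) ->
  exists al, forall i, u i ^+ k.+1 = al.
Proof.
move=> mom hg; exists (g (ord0, ord0)) => i; rewrite hg (bigD1 (ord0, ord0)) //=.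
rewrite /box_monomial !expr0 !mulr1 big1 ?addr0 // => t t0.
rewrite (relation_coef0 (t := t) _ mom (span_relation hg)) ?mul0r //; right.
case: t t0 => [t1 t2] /= t0; suff : (0 < t1 + t2)%N by lia.
by rewrite lt0n addn_eq0; apply: contra t0.
Qed.

(* If u^(k+1) is not in the span of the box monomials, replace the top monomial
   u^k v^k by it: the orthogonal complement of the resulting independent family
   contains both w and w u^(k+1). *)
Lemma power_const w u v : moments (3 * k) w u v -> (forall i, w i != 0) ->
  (#|I| <= (k.+1 ^ 2).+1)%N -> exists al, forall i, u i ^+ k.+1 = al.
Proof.
move=> mom w0 cardI.
pose top : box := (ord_max, ord_max).
pose f t i := if t == top then u i ^+ k.+1 else box_monomial u v t i.
have sum_f (g : box -> C) i : \sum_t g t * f t i =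
    g top * u i ^+ k.+1 + \sum_t (if t == top then 0 else g t) * box_monomial u v t i.
  rewrite (bigD1 top) //= [in RHS](bigD1 top) //= /f eqxx mul0r add0r.
  by congr +%R; apply: eq_bigr => t /negPf ->.
have [] := boolp.pselect (exists g : box -> C,
    forall i, u i ^+ k.+1 = \sum_t g t * box_monomial u v t i).
  by case=> g; apply: box_span_power_const mom.
move=> nspan; have indep : independent f.
  move=> g g0; have [gt0|gt0] := eqVneq (g top) 0.
    move=> t; have [->//|tt] := eqVneq t top.
    have := @relation_coef0 _ _ _ _ 0 (fun t => if t == top then 0 else g t) t _ mom.
    rewrite (negPf tt); apply; [lia | | by left].
    by move=> i; rewrite -[RHS](g0 i) sum_f gt0.
  (* A nonzero coefficient at [top] would let the relation be solved for u^(k+1). *)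
  case: nspan; exists (fun t => - (g top)^-1 * (if t == top then 0 else g t)) => i.
  under eq_bigr => t _ do rewrite -mulrA.
  rewrite -mulr_sumr; apply: (mulfI gt0).
  rewrite mulrA mulrN mulfV // mulN1r; apply/eqP; rewrite -addr_eq0.
  by rewrite -sum_f g0.
have [i0 _|I0] := pickP I; last by exists 0 => i; have := I0 i.
(* All moments involved have degree at most 3k. At [top] the degree is at most 2k + 2, which is
   where k >= 2 enters; any other t has degree at most 2k - 1, which leaves room for k + 1 more. *)
have orth j : (j == 0)%N || (j == k.+1)%N -> forall t, \sum_i f t i * (w i * u i ^+ j) = 0.
  move=> hj t; rewrite /f; have [tt|tt] := eqVneq t top.
    transitivity (\sum_i w i * u i ^+ (k.+1 + j) * v i ^+ 0).
      by apply: eq_bigr => i _; rewrite exprD expr0; ring.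
    rewrite mom; last by lia.
    by rewrite (_ : (_ == k) && _ = false) //; lia.
  have {}tt : ((t.1 : nat) == k) && ((t.2 : nat) == k) = false.
    by apply: contraNF tt => /andP[e1 e2]; rewrite -pair_eqE; apply/andP.
  transitivity (\sum_i w i * u i ^+ (t.1 + j) * v i ^+ t.2).
    by apply: eq_bigr => i _; rewrite /box_monomial exprD; ring.
  have := ltn_ord t.1; have := ltn_ord t.2 => h1 h2.
  rewrite mom; last by lia.
  by rewrite (_ : (_ == k) && _ = false) //; lia.
have hI : (#|I| <= #|{: box}|.+1)%N by rewrite card_box.
have /(independent_orthogonal indep hI)/(_ (orth k.+1 _))[] := orth 0%N isT.
- by rewrite eqxx orbT.
- by exists i0; rewrite expr0 mulr1 w0.
move=> al hal; exists al => i; apply: (mulfI (w0 i)).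
by rewrite hal expr0 mulr1 mulrC.
Qed.

(* On the k.+1 ^ 2 points of the chart, u^(k+1) agrees with a polynomial of degree
   at most one; multiply this relation by u^(2k-1). *)
Lemma line_point w u v (c s : C) : moments (3 * k).-1 w u v ->
  (#|I| <= k.+1 ^ 2)%N -> \sum_i w i * u i ^+ (3 * k) + c * s ^+ (3 * k) = 0 ->
  c != 0 -> s = 0.
Proof.
move=> mom cardI eq0 c0.
have hD : (3 * k <= (3 * k).-1.+1)%N by lia.
have := independent_span (fun i => u i ^+ k.+1) (box_independent hD mom).
rewrite card_box => /(_ cardI)[g hg].
suff sum0 : \sum_i w i * u i ^+ (3 * k) = 0.
  move: eq0; rewrite sum0 add0r => /eqP; rewrite mulf_eq0 (negPf c0) /=.
  by rewrite expf_eq0 => /andP[_ /eqP].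
transitivity (\sum_i w i * u i ^+ (2 * k - 1) * \sum_t g t * box_monomial u v t i).
  by apply: eq_bigr => i _; rewrite -hg -mulrA -exprD; congr (_ * _ ^+ _); lia.
under eq_bigr => i _ do rewrite mulr_sumr.
rewrite exchange_big /= big1 // => t _.
(* With D = 3k - 1, [relation_coef0] kills the coefficients of degree at least two. In degree at
   most one the exponent of v is below k, so the moment itself vanishes. *)
have [t2|t1] := leqP 2 (t.1 + t.2).
  apply: big1 => i _; rewrite (relation_coef0 hD mom (span_relation hg)) ?mul0r ?mulr0 //.
  by right; lia.
transitivity (g t * \sum_i w i * u i ^+ (2 * k - 1 + t.1) * v i ^+ t.2).
  by rewrite mulr_sumr; apply: eq_bigr => i _; rewrite /box_monomial exprD; ring.
rewrite mom; last by lia.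
by rewrite (_ : (_ == k) && _ = false) ?mulr0 //; lia.
Qed.

End AffinePoints.

(** * Passage from projective points to the chart, and the constraints on the points *)

Section ProjectivePoints.
Variables (C : fieldType) (k : nat) (mu : C).
Hypotheses (hk : (2 <= k)%N) (mu0 : mu != 0).
Variables (J : finType) (c x y z : J -> C).

Definition form_moments := forall e a b, (e + a + b = 3 * k)%N ->
  \sum_j c j * x j ^+ e * y j ^+ a * z j ^+ b = mu *+ ((a == k) && (b == k)).

Hypothesis mom : form_moments.

Let A := [pred j | x j != 0].
Let w (i : {j | j \in A}) := c (val i) * x (val i) ^+ (3 * k).
Let u (i : {j | j \in A}) := y (val i) / x (val i).
Let v (i : {j | j \in A}) := z (val i) / x (val i).

Let chart_sum a b : (a + b <= 3 * k)%N -> \sum_i w i * u i ^+ a * v i ^+ b =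
  \sum_(j in A) c j * x j ^+ (3 * k - (a + b)) * y j ^+ a * z j ^+ b.
Proof.
move=> hab; rewrite [RHS]big_sub; apply: eq_bigr => -[j /= xj0] _.
rewrite /w /u /v /= !expr_div_n -{1}(subnK hab) !exprD.
by field; rewrite !expf_neq0.
Qed.

(** Below degree 3k the exponent of x is positive, so points with x = 0 contribute nothing to the
    homogeneous moments. *)
Let chart_moments : moments k mu (3 * k).-1 w u v.
Proof.
move=> a b hab; rewrite chart_sum; last by lia.
rewrite -(mom (e := (3 * k - (a + b))%N)); last by lia.
rewrite [RHS](bigID (mem A)) /= [X in _ + X]big1 ?addr0 // => j.
rewrite inE negbK => /eqP ->; rewrite expr0n (_ : (_ == 0)%N = false); last by lia.
by rewrite !(mulr0, mul0r).
Qed.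

Lemma form_moments_card : (k.+1 ^ 2 <= #|J|)%N.
Proof.
apply: leq_trans (moments_card hk mu0 _ chart_moments) _; first by lia.
by rewrite card_sig max_card.
Qed.

Hypothesis c0 : forall j, c j != 0.
Hypothesis cardJ : (#|J| <= (k.+1 ^ 2).+1)%N.
Hypothesis xyz0 : forall j, [|| x j != 0, y j != 0 | z j != 0].

(** The chart contains at least N of the at most N + 1 points, so a point off the chart is the only
    one. The moments of y^(3k) and z^(3k) then satisfy the relation of [line_point], which forces y
    and z to vanish there as well. *)
Lemma form_x_neq0 j : x j != 0.
Proof.
apply/negP => /eqP xj0.
have hI : (k.+1 ^ 2 <= #|{: {j | j \in A}}|)%N.
  by apply: moments_card chart_moments => //; lia.
have cardA : (#|{: {j | j \in A}}| + #|[predC A]| = #|J|)%N by rewrite card_sig cardC.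
have hA : #|[predC A]| = 1%N.
  have : (0 < #|[predC A]|)%N by apply/card_gt0P; exists j; rewrite !inE xj0 eqxx.
  by lia.
have sumA (F : J -> C) : \sum_i F i = \sum_(i in A) F i + F j.
  rewrite (bigID (mem A)) /=; congr +%R.
  apply: big_pred1 => i.
  have /card_le1P/(_ j) hj := eq_leq hA.
  by have := hj _ i; rewrite !inE xj0 eqxx => <-.
have hI2 : (#|{: {j | j \in A}}| <= k.+1 ^ 2)%N by lia.
have line a b : (a + b = 3 * k)%N -> (a == k) && (b == k) = false ->
    \sum_i w i * u i ^+ a * v i ^+ b + c j * y j ^+ a * z j ^+ b = 0.
  move=> hab ab; rewrite chart_sum; last by lia.
  transitivity (\sum_j c j * x j ^+ (3 * k - (a + b)) * y j ^+ a * z j ^+ b).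
    by rewrite sumA hab subnn expr0 mulr1.
  by rewrite mom ?ab //; lia.
have := xyz0 j; rewrite xj0 eqxx /= -negb_and; apply/negP; rewrite negbK.
apply/andP; split; apply/eqP.
  apply: (line_point hk mu0 chart_moments hI2 _ (c0 j)).
  rewrite -[RHS](line (3 * k) 0)%N; [|lia|lia].
  by congr +%R; [apply: eq_bigr => i _|]; rewrite expr0 mulr1.
apply: (line_point hk mu0 (moments_swap chart_moments) hI2 _ (c0 j)).
rewrite -[RHS](line 0 (3 * k))%N; [|lia|lia].
by congr +%R; [apply: eq_bigr => i _|]; rewrite expr0 mulr1.
Qed.

Let chart_moments_full : moments k mu (3 * k) w u v.
Proof.
move=> a b hab; rewrite chart_sum //.
rewrite -(mom (e := (3 * k - (a + b))%N)); last by lia.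
by apply: eq_bigl => j; rewrite inE form_x_neq0.
Qed.

Let w0 i : w i != 0.
Proof. by rewrite mulf_neq0 ?expf_neq0 ?c0 ?form_x_neq0. Qed.

Let cardI : (#|{: {j | j \in A}}| <= (k.+1 ^ 2).+1)%N.
Proof. by rewrite card_sig (leq_trans (max_card _)). Qed.

Lemma form_power_y : exists2 al, al != 0 & forall j, y j ^+ k.+1 = al * x j ^+ k.+1.
Proof.
have [al hal] := power_const hk mu0 chart_moments_full w0 cardI.
have hy j : y j ^+ k.+1 = al * x j ^+ k.+1.
  have := hal (exist (fun j => j \in A) j (form_x_neq0 j)).
  by rewrite /u /= expr_div_n => <-; rewrite divfK // expf_neq0 ?form_x_neq0.
(* If al were zero, y would vanish at every point, and with it the moment e = a = b = k, whose value
   is mu. *)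
exists al => //; apply: contraNneq mu0 => al0.
have := mom (e := k) (a := k) (b := k); rewrite eqxx mulr1n => <-; last by lia.
apply/eqP/big1 => j _; have := hy j; rewrite al0 mul0r => /eqP.
rewrite expf_eq0 => /andP[_ /eqP ->].
by rewrite expr0n (_ : (_ == 0)%N = false) ?mulr0 ?mul0r //; lia.
Qed.

Lemma form_power_z : exists2 be, be != 0 & forall j, z j ^+ k.+1 = be * x j ^+ k.+1.
Proof.
have [be hbe] := power_const hk mu0 (moments_swap chart_moments_full) w0 cardI.
have hz j : z j ^+ k.+1 = be * x j ^+ k.+1.
  have := hbe (exist (fun j => j \in A) j (form_x_neq0 j)).
  by rewrite /v /= expr_div_n => <-; rewrite divfK // expf_neq0 ?form_x_neq0.
exists be => //; apply: contraNneq mu0 => be0.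
have := mom (e := k) (a := k) (b := k); rewrite eqxx mulr1n => <-; last by lia.
apply/eqP/big1 => j _; have := hz j; rewrite be0 mul0r => /eqP.
rewrite expf_eq0 => /andP[_ /eqP ->].
by rewrite expr0n (_ : (_ == 0)%N = false) ?mulr0 ?mul0r //; lia.
Qed.

End ProjectivePoints.

(** * Counting points whose coordinates have prescribed powers *)

Lemma card_root_values (C : fieldType) (n : nat) (al : C) (J : finType) (u : J -> C) :
  (forall j, u j ^+ n.+1 = al) -> (size (undup (codom u)) <= n.+1)%N.
Proof.
move=> hu; have p0 : 'X^(n.+1) - al%:P != 0 by rewrite -size_poly_eq0 size_XnsubC.
rewrite -ltnS -(size_XnsubC al (ltn0Sn n)) max_poly_roots ?undup_uniq //.
apply/allP => r; rewrite mem_undup => /codomP[j ->].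
by rewrite /root !hornerE hu subrr.
Qed.

Lemma card_power_points (C : fieldType) (k : nat) (al be : C) (J : finType)
  (u v : J -> C) : injective (fun j => (u j, v j)) ->
  (forall j, u j ^+ k.+1 = al) -> (forall j, v j ^+ k.+1 = be) ->
  (#|J| <= k.+1 ^ 2)%N.
Proof.
move=> inj hu hv.
rewrite cardE -(size_map (fun j => (u j, v j))).
apply: (@leq_trans (size (allpairs pair (undup (codom u)) (undup (codom v))))).
  apply: uniq_leq_size; first by rewrite map_inj_uniq ?enum_uniq.
  move=> p /mapP[j _ ->]; apply/allpairsP; exists (u j, v j) => /=.
  by rewrite !mem_undup !codom_f.
rewrite size_allpairs expnS expn1 leq_mul ?(card_root_values hu) ?(card_root_values hv) //.
Qed.

(** * Coefficients of sums of powers of ternary linear forms *)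

Definition mnm3 (e a b : nat) : 'X_{1..3} := (U_(0%R) *+ e + U_(1%R) *+ a + U_(2%R) *+ b)%MM.

Lemma mnm3_inj e a b e' a' b' :
  (mnm3 e a b == mnm3 e' a' b') = [&& e == e', a == a' & b == b'].
Proof.
apply/eqP/and3P => [/mnmP h|[/eqP-> /eqP-> /eqP->] //].
have := h 0; have := h 1; have := h 2.
rewrite /mnm3 !mnmDE !mulmnE !mnm1E /= !mul0n !mul1n !addn0 !add0n.
by move=> -> -> ->.
Qed.

Section Expansion.
Variable C : numFieldType.

Lemma mnm3E e a b : 'X_0 ^+ e * 'X_1 ^+ a * 'X_2 ^+ b = 'X_[mnm3 e a b] :> {mpoly C[3]}.
Proof. by rewrite /mnm3 !mpolyXD !mpolyXn. Qed.

(** The multinomial coefficient of exponents (d - a - b, a, b), in the shape given by two uses of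
    the binomial theorem. *)
Definition trinomial (d a b : nat) := ('C(d - b, a) * 'C(d, b))%N.

Lemma trinomial_neq0 e a b : (trinomial (e + a + b) a b)%:R != 0 :> C.
Proof. by rewrite pnatr_eq0 -lt0n muln_gt0 !bin_gt0; lia. Qed.

Lemma ternary_linear_expr (x y z : C) d : ternary_linear x y z ^+ d =
  \sum_(b < d.+1) \sum_(a < (d - b).+1)
    ((trinomial d a b)%:R * (x ^+ (d - b - a) * y ^+ a * z ^+ b)) *:
      'X_[mnm3 (d - b - a) a b].
Proof.
rewrite /ternary_linear exprDn; apply: eq_bigr => b _.
rewrite exprDn mulr_suml -sumrMnl; apply: eq_bigr => a _.
rewrite -mnm3E /trinomial !exprZn natrM mulrnAl.
rewrite -!scalerAr -!scalerAl -!scaler_nat !scalerA.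
by congr (_ *: _); ring.
Qed.

Lemma sum_ternary_linear_expr (J : finType) (c x y z : J -> C) d :
  \sum_j c j *: ternary_linear (x j) (y j) (z j) ^+ d =
  \sum_(b < d.+1) \sum_(a < (d - b).+1)
    ((trinomial d a b)%:R * \sum_j c j * x j ^+ (d - b - a) * y j ^+ a * z j ^+ b) *:
      'X_[mnm3 (d - b - a) a b].
Proof.
under eq_bigr => j _ do rewrite ternary_linear_expr scaler_sumr.
rewrite exchange_big; apply: eq_bigr => b _.
under eq_bigr => j _ do rewrite scaler_sumr.
rewrite exchange_big; apply: eq_bigr => a _.
rewrite mulr_sumr scaler_suml; apply: eq_bigr => j _.
by rewrite scalerA; congr (_ *: _); ring.
Qed.

Lemma mcoeff_sum_ternary_linear (J : finType) (c x y z : J -> C) e a b :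
  (\sum_j c j *: ternary_linear (x j) (y j) (z j) ^+ (e + a + b))@_(mnm3 e a b) =
  (trinomial (e + a + b) a b)%:R * \sum_j c j * x j ^+ e * y j ^+ a * z j ^+ b.
Proof.
rewrite sum_ternary_linear_expr !raddf_sum /=.
have hb : (b < (e + a + b).+1)%N by lia.
have ha : (a < (e + a + b - b).+1)%N by lia.
rewrite (bigD1 (Ordinal hb)) //= [X in _ + X]big1 ?addr0; last first.
  move=> b' bb'; rewrite raddf_sum big1 // => a' _ /=.
  rewrite mcoeffZ mcoeffX mnm3_inj !andbA andbC.
  rewrite (_ : (b' == b :> nat) = false) ?mulr0 //.
  by apply: contraNF bb' => /eqP ?; apply/eqP/val_inj.
rewrite raddf_sum (bigD1 (Ordinal ha)) //= [X in _ + X]big1 ?addr0; last first.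
  move=> a' aa'; rewrite mcoeffZ mcoeffX mnm3_inj andbCA.
  rewrite (_ : (a' == a :> nat) = false) ?mulr0 //.
  by apply: contraNF aa' => /eqP ?; apply/eqP/val_inj.
rewrite mcoeffZ mcoeffX (_ : e + a + b - b - a = e)%N; last by lia.
by rewrite eqxx mulr1.
Qed.

(** The value of mu that gives (x0 x1 x2)^k coefficient one. *)
Definition top_moment k : C := (trinomial (3 * k) k k)%:R^-1.

Lemma top_moment_neq0 k : top_moment k != 0.
Proof.
by rewrite invr_eq0 (_ : 3 * k = k + k + k)%N ?trinomial_neq0 //; lia.
Qed.

Definition monomial_form k : {mpoly C[3]} := 'X_0 ^+ k * 'X_1 ^+ k * 'X_2 ^+ k.

(** Coefficients are moments times trinomials, and the latter are invertible in characteristic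
    zero. *)
Lemma monomial_form_moments k (J : finType) (c x y z : J -> C) :
  \sum_j c j *: ternary_linear (x j) (y j) (z j) ^+ (3 * k) = monomial_form k <->
  form_moments k (top_moment k) c x y z.
Proof.
split=> [sumE e a b d | mom].
  have trin0 := trinomial_neq0 e a b; apply: (mulfI trin0); move: trin0.
  rewrite -mcoeff_sum_ternary_linear d => trin0; rewrite sumE /monomial_form mnm3E mcoeffX mnm3_inj.
  rewrite (_ : [&& _, _ & _] = ((a == k) && (b == k))); last by lia.
  case: andP trin0 => [[/eqP -> /eqP ->] trin0|_ _]; last by rewrite mulr0.
  by rewrite mulr1n mulfV.
rewrite sum_ternary_linear_expr /monomial_form mnm3E.
have hk : (k < (3 * k).+1)%N by lia.
have hk2 : (k < (3 * k - k).+1)%N by lia.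
have zero a b : (a + b <= 3 * k)%N -> (a == k) && (b == k) = false ->
   \sum_j c j * x j ^+ (3 * k - b - a) * y j ^+ a * z j ^+ b = 0.
  by move=> h ab; rewrite mom ?ab //; lia.
rewrite (bigD1 (Ordinal hk)) //= [X in _ + X]big1 ?addr0; last first.
  move=> b bk; rewrite big1 // => a _; rewrite zero ?mulr0 ?scale0r //.
    by have := ltn_ord a; have := ltn_ord b; lia.
  by apply: contraNF bk => /andP[_ ?]; apply/eqP/val_inj/eqP.
rewrite (bigD1 (Ordinal hk2)) //= [X in _ + X]big1 ?addr0; last first.
  move=> a ak; rewrite zero ?mulr0 ?scale0r //.
    by have := ltn_ord a; lia.
  by apply: contraNF ak => /andP[? _]; apply/eqP/val_inj/eqP.
rewrite mom ?eqxx ?mulr1n /top_moment ?mulfV ?scale1r; last by lia.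
  by congr 'X_[mnm3 _ _ _]; lia.
by have := top_moment_neq0 k; rewrite invr_eq0.
Qed.

End Expansion.

(** * Roots of unity and an explicit solution of the moment identities *)

Lemma prim_root_exists (C : numClosedFieldType) n : (0 < n)%N ->
  exists z : C, n.-primitive_root z.
Proof.
pose p : {poly C} := 'X^n - 1; have [r Dp] := closed_field_poly_normal p.
move=> n_gt0; rewrite (monicP _) ?monicXnsubC // scale1r in Dp.
have rn1 : all n.-unity_root r by apply/allP => z; rewrite -root_prod_XsubC -Dp.
have sz_r : (n < (size r).+1)%N.
  by rewrite -(size_prod_XsubC r id) -Dp size_XnsubC.
(* Separability of X^n - 1 makes its n roots distinct, and n distinct n-th roots of unity include a
   primitive one. *)
have [|z _ hz] := hasP (has_prim_root n_gt0 rn1 _ sz_r); last by exists z.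
by rewrite -separable_prod_XsubC -Dp separable_Xn_sub_1 // pnatr_eq0 -lt0n.
Qed.

Lemma sum_prim_root (F : fieldType) n (z : F) m : n.-primitive_root z ->
  \sum_(i < n) (z ^+ m) ^+ i = if (n %| m)%N then n%:R else 0.
Proof.
move=> hz; rewrite (prim_order_dvd hz); case: eqVneq => [->|zm1].
  by under eq_bigr do rewrite expr1n; rewrite sumr_const card_ord.
have /eqP := subrX1 (z ^+ m) n; rewrite exprAC (prim_expr_order hz) expr1n subrr.
by rewrite eq_sym mulf_eq0 subr_eq0 (negPf zm1) => /eqP.
Qed.

(** The points form the orbit of (a0, a1, a2) under scaling the last two coordinates by (k+1)-st
    roots of unity. The character sums select a and b congruent to k modulo k + 1; since e + a + b =
    3k, a larger value such as 2k + 1 for one of them leaves less than k for the other, so a = b =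
    k. *)
Lemma root_of_unity_moments (C : numClosedFieldType) k (mu a0 a1 a2 z : C) :
  (2 <= k)%N -> a0 * a1 * a2 != 0 -> k.+1.-primitive_root z ->
  exists w, form_moments (J := ('I_k.+1 * 'I_k.+1)%type) k mu
    (fun t => w * z ^+ t.1 * z ^+ t.2) (fun=> a0)
    (fun t => a1 * z ^+ t.1) (fun t => a2 * z ^+ t.2).
Proof.
move=> hk; rewrite !mulf_eq0 !negb_or => /andP[/andP[a00 a10] a20] hz.
(* Normalization of the surviving moment: each of the two character sums contributes a factor k +
   1. *)
exists (mu / (a0 ^+ k * a1 ^+ k * a2 ^+ k * k.+1%:R ^+ 2)) => e a b hab.
set w := mu / _.
transitivity (\sum_(i < k.+1) \sum_(j < k.+1) w * a0 ^+ e * a1 ^+ a * a2 ^+ b *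
   ((z ^+ a.+1) ^+ i * (z ^+ b.+1) ^+ j)).
  rewrite pair_bigA; apply: eq_bigr => -[i j] _ /=.
  by rewrite !exprMn -!exprM !mulSn !exprD ![(_ * a)%N]mulnC ![(_ * b)%N]mulnC; ring.
under eq_bigr => i _ do rewrite -mulr_sumr -mulr_sumr.
rewrite -mulr_sumr -mulr_suml !(sum_prim_root _ hz).
have dvd_le n : (k.+1 %| n.+1)%N -> n = k \/ (2 * k.+1 <= n.+1)%N.
  by case/dvdnP => [[|[|q]] hq]; [lia | left; lia | right; rewrite hq leq_mul].
have [/dvd_le ha|ha] := ifP; last first.
  rewrite mul0r mulr0 (_ : _ && _ = false) //.
  by apply: contraFF ha => /andP[/eqP -> _].
have [/dvd_le hb|hb] := ifP; last first.
  rewrite !mulr0 (_ : _ && _ = false) //.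
  by apply: contraFF hb => /andP[_ /eqP ->].
have [-> ->] : a = k /\ b = k by lia.
have -> : e = k by lia.
rewrite !eqxx mulr1n /w; field.
by rewrite !expf_neq0 // addrC natr1 pnatr_eq0.
Qed.

(** * Waring rank in terms of finite sets of projective points *)

Section ProjectiveForms.
Variables (C : numClosedFieldType) (n d : nat).
Hypothesis d_gt0 : (0 < d)%N.
Implicit Types (f : {mpoly C[n.+1]}) (p q : proj_point C n) (X Y : {fset proj_point C n}).
Implicit Types (l : linear_form C n).

(** [repr_form] before the coercion to polynomials, kept in the vector space of linear forms. *)
Definition point_form p : linear_form C n := vpick (val p).

Lemma dim_point p : \dim (val p) = 1%N.
Proof. exact: (eqP (valP p)). Qed.

Lemma point_form_neq0 p : point_form p != 0.
Proof. by rewrite vpick0 -dimv_eq0 dim_point. Qed.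

Lemma proj_pointE p : val p = <[point_form p]>%VS.
Proof.
apply/esym/eqP; rewrite eqEdim -memvE memv_pick dim_vline point_form_neq0.
by rewrite dim_point.
Qed.

Lemma proj_point_inj p q c : c != 0 -> point_form p = c *: point_form q -> p = q.
Proof.
move=> c0 e; apply/val_inj; rewrite /= !proj_pointE.
apply/eqP; rewrite eqEdim -memvE !dim_vline !point_form_neq0 andbT.
by rewrite e; apply/memvZ/memv_line.
Qed.

Lemma point_of_form l : l != 0 -> exists p c, c != 0 /\ l = c *: point_form p.
Proof.
move=> l0; have dl : \dim <[l]>%VS == 1%N by rewrite dim_vline l0.
pose p : proj_point C n := exist _ <[l]>%VS dl.
have /vlineP[c hc] : l \in <[point_form p]>%VS by rewrite -proj_pointE memv_line.
by exists p, c; split=> //; apply: contraNneq l0 => c0; rewrite hc c0 scale0r.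
Qed.

Lemma sum_fset_extend (X Y : {fset proj_point C n}) (c : proj_point C n -> C) : X `<=` Y ->
  \sum_(p <- Y) (if p \in X then c p else 0) *: repr_form p ^+ d =
  \sum_(p <- X) c p *: repr_form p ^+ d.
Proof.
move=> XY; rewrite -(big_fset_incl _ XY) => [|p _ /negPf ->]; last by rewrite scale0r.
by apply: eq_big_seq => p ->.
Qed.

Lemma sum_fset_single X p a : p \in X ->
  \sum_(q <- X) (if q == p then a else 0) *: repr_form q ^+ d = a *: repr_form p ^+ d.
Proof.
move=> pX; rewrite (big_fsetD1 p) //= eqxx big_seq_cond big1 ?addr0 // => q.
by rewrite !inE andbT => /andP[/negPf -> _]; rewrite scale0r.
Qed.

(** A new power costs at most one point, and none if l = 0. The last clause records where the point
    of l went, so that a decomposition through a prescribed point can be built. *)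
Lemma waring_decomposition_add f X l a : waring_decomposition d f X ->
  exists Y, [/\ X `<=` Y, (#|` Y| <= #|` X|.+1)%N,
    waring_decomposition d (f + a *: (l : {mpoly C[n.+1]}) ^+ d) Y &
    forall p c, c != 0 -> l = c *: point_form p -> p \in Y].
Proof.
case=> c ->; have [->|/point_of_form[p [b [b0 lE]]]] := eqVneq l 0.
  exists X; split=> //; first by exists c; rewrite expr0n gtn_eqF // scaler0 addr0.
  move=> p b b0 /esym/eqP; rewrite scaler_eq0 (negPf b0).
  by rewrite (negPf (point_form_neq0 p)).
exists (p |` X); split.
- by rewrite fsubsetU1.
- by rewrite cardfsU1; case: (_ \notin _).
- exists (fun q => (if q \in X then c q else 0) + (if q == p then a * b ^+ d else 0)).
  under [RHS]eq_bigr => q _ do rewrite scalerDl.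
  rewrite big_split /= sum_fset_extend ?fsubsetU1 // sum_fset_single ?fset1U1 //.
  by rewrite lE linearZ /= exprZn scalerA.
- move=> q b' b'0 lE'; rewrite (@proj_point_inj q p (b'^-1 * b)) ?fset1U1 //.
    by rewrite mulf_neq0 ?invr_eq0.
  by rewrite -scalerA -lE lE' scalerA mulVf // scale1r.
Qed.

Lemma waring_decomposition_sum (s : seq (C * linear_form C n)) :
  exists X, [/\ (#|` X| <= size s)%N,
    waring_decomposition d (\sum_(t <- s) t.1 *: (t.2 : {mpoly C[n.+1]}) ^+ d) X &
    forall t p c, t \in s -> c != 0 -> t.2 = c *: point_form p -> p \in X].
Proof.
elim: s => [|[a l] s [X [cardX decX inX]]].
  exists fset0; split=> //; exists (fun=> 0).
  by rewrite big_nil big_seq_fset0.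
have [Y [XY cardY decY inY]] := waring_decomposition_add l a decX.
exists Y; split; first by rewrite (leq_trans cardY).
  by rewrite big_cons addrC.
move=> t p c; rewrite inE => /predU1P[-> /=|ts]; first exact: inY.
by move=> c0 tE; apply: (fsubsetP XY); apply: inX ts c0 tE.
Qed.

Lemma waring_decomposition_of_sum f r : sum_of_powers d f r ->
  exists2 X, (#|` X| <= r)%N & waring_decomposition d f X.
Proof.
case=> l ->; have [X [cardX decX _]] :=
  waring_decomposition_sum [seq (1, l i) | i <- enum 'I_r].
exists X; first by rewrite (leq_trans cardX) // size_map size_enum_ord.
move: decX; rewrite big_map big_enum /=.
by under eq_bigr do rewrite scale1r.
Qed.

Lemma sum_of_powers_cons f r l : sum_of_powers d f r ->
  sum_of_powers d ((l : {mpoly C[n.+1]}) ^+ d + f) r.+1.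
Proof.
case=> m ->; exists (fun i => if unlift ord0 i is Some j then m j else l).
rewrite big_ord_recl unlift_none; congr +%R.
by apply: eq_bigr => i _; rewrite liftK.
Qed.

Lemma sum_of_powers_leq f r s : (r <= s)%N -> sum_of_powers d f r -> sum_of_powers d f s.
Proof.
move=> /subnK <-; elim: (s - r)%N => // m IH /IH/(sum_of_powers_cons 0).
by rewrite linear0 expr0n gtn_eqF // add0r.
Qed.

(** Over an algebraically closed field a d-th root of each coefficient can be absorbed into its
    form. *)
Lemma sum_of_powers_decomposition f X : waring_decomposition d f X ->
  sum_of_powers d f #|` X|.
Proof.
case=> c ->; elim: (X : seq _) => [|p s IH].
  by rewrite big_nil; exists (fun=> 0); rewrite big_ord0.
rewrite big_cons; have := sum_of_powers_cons (d.-root (c p) *: point_form p) IH.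
by rewrite linearZ /= exprZn rootCK.
Qed.

Lemma waring_rank_decomposition f r :
  (exists2 X, (#|` X| <= r)%N & waring_decomposition d f X) ->
  (forall X, waring_decomposition d f X -> (r <= #|` X|)%N) -> waring_rank d f r.
Proof.
move=> [X cardX decX] low; split.
  exact: sum_of_powers_leq cardX (sum_of_powers_decomposition decX).
by move=> s /waring_decomposition_of_sum[] // Y cardY /low hr; exact: leq_trans hr cardY.
Qed.

Lemma waring_rank_unique f r s : waring_rank d f r -> waring_rank d f s -> r = s.
Proof.
by move=> [hr minr] [hs mins]; apply/anti_leq; rewrite minr ?mins.
Qed.

End ProjectiveForms.

(** * Coordinates of points in the plane of ternary linear forms *)

Section TernaryForms.
Variable C : numClosedFieldType.
Implicit Types (p q L : proj_point C 2) (X Y : {fset proj_point C 2}).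

Lemma mcoeff_ternary_linear (x y z : C) : let l := ternary_linear x y z in
  [/\ l@_U_(0) = x, l@_U_(1) = y & l@_U_(2) = z].
Proof.
by split; rewrite !mcoeffD !mcoeffZ !mcoeffXU /= !mulr0 mulr1 ?addr0 ?add0r.
Qed.

Lemma ternary_linear_homog (x y z : C) : ternary_linear x y z \is 1.-homog.
Proof. by do !apply: rpredD; apply: rpredZ; rewrite dhomogX; apply/eqP; apply: mdeg1. Qed.

Lemma linear_formE (l : linear_form C 2) : (l : {mpoly C[3]}) =
  ternary_linear (l : {mpoly C[3]})@_U_(0) (l : {mpoly C[3]})@_U_(1)
                 (l : {mpoly C[3]})@_U_(2).
Proof.
set x := _@__; set y := (X in ternary_linear _ X); set z := (X in ternary_linear _ _ X).
have [hx hy hz] := mcoeff_ternary_linear x y z.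
have hom := ternary_linear_homog x y z.
apply/mpolyP => m; have [/eqP/mdeg1P[i /eqP ->]|m1] := eqVneq (mdeg m) 1%N.
  have : i \in [:: 0; 1; 2] by case: i => [[|[|[|]]]].
  by rewrite !inE => /or3P[] /eqP ->; rewrite ?hx ?hy ?hz.
rewrite (dhomog_nemf_coeff hom m1) (dhomog_nemf_coeff _ m1) //.
exact: dhomog_is_dhomog.
Qed.

Definition ternary_form (x y z : C) : linear_form C 2 := DHomog (ternary_linear_homog x y z).

Definition coord (i : 'I_3) p : C := (repr_form p)@_U_(i).

Lemma repr_formE p : repr_form p = ternary_linear (coord 0 p) (coord 1 p) (coord 2 p).
Proof. exact: linear_formE. Qed.

Lemma ternary_linearZ (s x y z : C) :
  ternary_linear (s * x) (s * y) (s * z) = s *: ternary_linear x y z.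
Proof. by rewrite /ternary_linear !scalerDr !scalerA. Qed.

Lemma ternary_form_coord (x y z s : C) p : ternary_form x y z = s *: point_form p ->
  [/\ x = s * coord 0 p, y = s * coord 1 p & z = s * coord 2 p].
Proof.
move=> /(congr1 val) /= e; have [hx hy hz] := mcoeff_ternary_linear x y z.
have coordE i : (ternary_linear x y z)@_U_(i) = s * coord i p.
  by rewrite e -mcoeffZ.
by split; rewrite -coordE.
Qed.

Lemma coord_neq0 p : [|| coord 0 p != 0, coord 1 p != 0 | coord 2 p != 0].
Proof.
rewrite -!negb_and; apply: contra (point_form_neq0 p) => /and3P[/eqP e0 /eqP e1 /eqP e2].
apply/eqP/val_inj; change (repr_form p = 0); rewrite repr_formE e0 e1 e2.
by rewrite /ternary_linear !scale0r !addr0.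
Qed.

Lemma coord_inj p q (s : C) : s != 0 -> (forall i, coord i p = s * coord i q) -> p = q.
Proof.
move=> s0 e; apply: (proj_point_inj s0); apply/val_inj.
change (repr_form p = s *: repr_form q).
by rewrite !repr_formE !e ternary_linearZ.
Qed.

(** * Decompositions of the monomial: size, position and uniqueness *)

Section Degree.
Variable k : nat.
Hypothesis hk : (2 <= k)%N.
Local Notation N := (k.+1 ^ 2)%N.

Definition decomposes X (c : proj_point C 2 -> C) :=
  \sum_(p <- X) c p *: repr_form p ^+ (3 * k) = monomial_form C k.

Lemma decomposes_moments X c : decomposes X c ->
  form_moments k (top_moment C k) (fun p : X => c (val p)) (fun p : X => coord 0 (val p))
    (fun p : X => coord 1 (val p)) (fun p : X => coord 2 (val p)).
Proof.
move=> dec; apply/monomial_form_moments; rewrite -dec big_seq_fsetE.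
by apply: eq_bigr => p _; rewrite -repr_formE.
Qed.

Lemma decomposes_card X c : decomposes X c -> (N <= #|` X|)%N.
Proof.
by move=> /decomposes_moments/(form_moments_card hk (top_moment_neq0 _ _)); rewrite cardfE.
Qed.

(** In the chart these are the common points of the curves u^(k+1) = al and v^(k+1) = be. *)
Definition on_power_curves (al be : C) p :=
  [/\ coord 0 p != 0, coord 1 p ^+ k.+1 = al * coord 0 p ^+ k.+1 &
      coord 2 p ^+ k.+1 = be * coord 0 p ^+ k.+1].

Lemma decomposes_on_power_curves X c : decomposes X c -> {in X, forall p, c p != 0} ->
  (#|` X| <= N.+1)%N -> exists al be, [/\ al != 0, be != 0 &
    {in X, forall p, on_power_curves al be p}].
Proof.
move=> /decomposes_moments mom c0; rewrite cardfE => cardX.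
have c0' (p : X) : c (val p) != 0 by rewrite c0 ?(valP p).
have x0 (p : X) := coord_neq0 (val p).
have [al al0 hal] := form_power_y hk (top_moment_neq0 C k) mom c0' cardX x0.
have [be be0 hbe] := form_power_z hk (top_moment_neq0 C k) mom c0' cardX x0.
exists al, be; split=> // p pX; split.
- exact: (form_x_neq0 hk (top_moment_neq0 C k) mom c0' cardX x0 [` pX]).
- exact: (hal [` pX]).
- exact: (hbe [` pX]).
Qed.

Lemma power_curves_card X al be : {in X, forall p, on_power_curves al be p} ->
  (#|` X| <= N)%N.
Proof.
move=> onX; rewrite cardfE.
apply: (@card_power_points C k al be _ (fun p : X => coord 1 (val p) / coord 0 (val p))
  (fun p : X => coord 2 (val p) / coord 0 (val p))).
- move=> p q [e1 e2]; apply/val_inj.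
  have [p0 _ _] := onX _ (valP p); have [q0 _ _] := onX _ (valP q).
  apply: (@coord_inj _ _ (coord 0 (val p) / coord 0 (val q))); first by rewrite mulf_neq0 ?invr_eq0.
  move=> i; have : i \in [:: 0; 1; 2] by case: i => [[|[|[|]]]].
  rewrite !inE => /or3P[] /eqP ->.
  + by rewrite divfK.
  + by rewrite mulrAC -mulrA -e1 mulrC divfK.
  + by rewrite mulrAC -mulrA -e2 mulrC divfK.
- by move=> p; have [p0 e _] := onX _ (valP p); rewrite expr_div_n e mulfK // expf_neq0.
- by move=> p; have [p0 _ e] := onX _ (valP p); rewrite expr_div_n e mulfK // expf_neq0.
Qed.

(** The common point L determines al and be, so X and Y lie on the same pair of curves. Their union
    then has at most N points while each of them has at least N. *)
Lemma decomposes_unique_points X Y c c' L : decomposes X c -> decomposes Y c' ->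
  {in X, forall p, c p != 0} -> {in Y, forall p, c' p != 0} ->
  (#|` X| <= N.+1)%N -> (#|` Y| <= N.+1)%N -> L \in X -> L \in Y -> X = Y.
Proof.
move=> decX decY c0 c'0 cardX cardY LX LY.
have [al [be [_ _ onX]]] := decomposes_on_power_curves decX c0 cardX.
have [al' [be' [_ _ onY]]] := decomposes_on_power_curves decY c'0 cardY.
have [L0 eal ebe] := onX L LX; have [_ eal' ebe'] := onY L LY.
have L0k : coord 0 L ^+ k.+1 != 0 by rewrite expf_neq0.
have {eal eal'} hal : al' = al by apply: (mulIf L0k); rewrite -eal -eal'.
have {ebe ebe'} hbe : be' = be by apply: (mulIf L0k); rewrite -ebe -ebe'.
have cardXY : (#|` X `|` Y| <= N)%N.
  apply: (@power_curves_card _ al be) => p; rewrite inE => /orP[/onX //|/onY].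
  by rewrite hal hbe.
transitivity (X `|` Y).
  by apply/eqP; rewrite eqEfcard fsubsetUl (leq_trans cardXY) // (decomposes_card decX).
by apply/esym/eqP; rewrite eqEfcard fsubsetUr (leq_trans cardXY) // (decomposes_card decY).
Qed.

(* Two different coefficient systems on N points would have an affine combination
   vanishing at one of them. *)
Lemma decomposes_unique_coefs X c c' : decomposes X c -> decomposes X c' ->
  (#|` X| <= N)%N -> {in X, c =1 c'}.
Proof.
move=> dec dec' cardX p pX; apply/eqP/negPn/negP => ne.
have ne' : c p - c' p != 0 by rewrite subr_eq0.
pose t := c p / (c p - c' p).
have cp0 : c p + t * (c' p - c p) = 0 by rewrite /t; field.
have : decomposes (X `\ p) (fun q => c q + t * (c' q - c q)).
  rewrite /decomposes.
  transitivity (\sum_(q <- X) (c q + t * (c' q - c q)) *: repr_form q ^+ (3 * k)).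
    by rewrite [RHS](big_fsetD1 p) //= cp0 scale0r add0r.
  under eq_bigr => q _ do rewrite scalerDl -scalerA scalerBl.
  by rewrite big_split /= -scaler_sumr sumrB dec dec' subrr scaler0 addr0.
by move/decomposes_card; have := cardfsD1 p X; rewrite pX; lia.
Qed.

Lemma decomposes_support X c : decomposes X c ->
  decomposes [fset p in X | c p != 0] c.
Proof.
move=> dec; rewrite /decomposes -[RHS]dec; apply: big_fset_incl; first exact: fset_sub.
by move=> p pX; rewrite !inE pX /= negbK => /eqP ->; rewrite scale0r.
Qed.

(** A zero coefficient would leave a decomposition with fewer than N points. *)
Lemma decomposes_neq0 X c : decomposes X c -> (#|` X| <= N)%N -> {in X, forall p, c p != 0}.
Proof.
move=> /decomposes_support/decomposes_card cardS cardX p pX.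
have /eqP eS : [fset p in X | c p != 0] == X.
  by rewrite eqEfcard fset_sub (leq_trans cardX).
by move: pX; rewrite -eS !inE => /andP[].
Qed.

(** * Trading decompositions of f for decompositions of the monomial *)

Section AddPower.
Variables (a0 a1 a2 s : C) (L : proj_point C 2).
Hypotheses (s0 : s != 0) (LE : ternary_form a0 a1 a2 = s *: point_form L).

Lemma ternary_linear_power : ternary_linear a0 a1 a2 ^+ (3 * k) =
  s ^+ (3 * k) *: repr_form L ^+ (3 * k).
Proof. by rewrite -exprZn; congr (_ ^+ _); have /(congr1 val) := LE. Qed.

(** The root-of-unity orbit gives at most N points; the lower bound shows that they are N distinct
    ones with nonzero coefficients. *)
Lemma monomial_decomposition : a0 * a1 * a2 != 0 ->
  exists S w, [/\ decomposes S w, #|` S| = N, {in S, forall p, w p != 0} & L \in S].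
Proof.
move=> aaa; have [z hz] := prim_root_exists C (ltn0Sn k).
have [w mom] := root_of_unity_moments (top_moment C k) hk aaa hz.
have d0 : (0 < 3 * k)%N by lia.
have [S [cardS [b decS] inS]] := waring_decomposition_sum d0
  [seq (w * z ^+ t.1 * z ^+ t.2, ternary_form a0 (a1 * z ^+ t.1) (a2 * z ^+ t.2))
  | t : 'I_k.+1 * 'I_k.+1 <- enum {: 'I_k.+1 * 'I_k.+1}].
move/monomial_form_moments: mom => mom.
rewrite big_map big_enum /= mom in decS.
rewrite size_map -cardE card_box in cardS.
have dec : decomposes S b by [].
exists S, b; split=> //.
- by apply/anti_leq; rewrite cardS (decomposes_card dec).
- exact: decomposes_neq0 dec cardS.
- apply: (inS (w, ternary_form a0 a1 a2) L s) => //.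
  (* The trivial pair of roots of unity yields the original form, that is, the point L. *)
  by apply/mapP; exists (ord0, ord0); rewrite ?mem_enum //= expr0 !mulr1.
Qed.

Variable lambda : C.
Hypothesis lambda0 : lambda != 0.

Lemma f_decomposes Y c : f_ k a0 a1 a2 lambda = \sum_(p <- Y) c p *: repr_form p ^+ (3 * k) ->
  decomposes (L |` Y) (fun q => (if q \in Y then c q else 0)
    + (if q == L then - (lambda * s ^+ (3 * k)) else 0)).
Proof.
move=> fE; rewrite /decomposes; under eq_bigr => q _ do rewrite scalerDl.
rewrite big_split /= sum_fset_extend ?fsubsetU1 // sum_fset_single ?fset1U1 //.
by rewrite -fE /f_ ternary_linear_power scalerA scaleNr addrK.
Qed.

(** X is the support of M = f - lambda l^(3k) on Y with L added. If L were not in X, its coefficient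
    would be zero, which requires L in Y because lambda s^(3k) is nonzero; X would then lie in Y
    minus L and have fewer than N points. If L is not in Y, its coefficient is exactly -lambda
    s^(3k), whence the last clause. *)
Lemma f_decomposition Y : (#|` Y| <= N)%N ->
  waring_decomposition (3 * k) (f_ k a0 a1 a2 lambda) Y ->
  exists X b, [/\ decomposes X b, {in X, forall p, b p != 0}, (#|` X| <= N.+1)%N, L \in X &
    {in X, forall p, p != L -> p \in Y} /\
    (b L + lambda * s ^+ (3 * k) != 0 -> L \in Y)].
Proof.
move=> cardY [c /f_decomposes].
set b := fun q : proj_point C 2 => _; set Z := L |` Y => decZ.
pose X := [fset p in Z | b p != 0].
have decX : decomposes X b by exact: decomposes_support.
have inX p : p \in X -> p != L -> p \in Y.
  by rewrite !inE => /andP[/orP[->|->//] _].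
have bL : L \notin Y -> b L = - (lambda * s ^+ (3 * k)).
  by rewrite /b eqxx => /negPf ->; rewrite add0r.
exists X, b; split=> //.
- by move=> p; rewrite !inE => /andP[].
- apply: leq_trans (fsubset_leq_card (fset_sub _ _)) _.
  by rewrite cardfsU1 -[N.+1]add1n leq_add ?leq_b1.
- apply/negPn/negP => LX; have bL0 : b L = 0.
    by move: LX; rewrite !inE eqxx /= negbK => /eqP.
  have LY : L \in Y.
    apply/negPn/negP => /bL; rewrite bL0 => /eqP; rewrite eq_sym oppr_eq0 mulf_eq0.
    by rewrite (negPf lambda0) expf_eq0 (negPf s0) andbF.
  have : X `<=` Y `\ L.
    apply/fsubsetP => p pX; rewrite in_fsetD1.
    have pL : p != L by apply: contraNneq LX => <-.
    by rewrite pL inX.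
  by move/fsubset_leq_card; have := decomposes_card decX; have := cardfsD1 L Y; rewrite LY; lia.
split=> // h; apply/negPn/negP => /bL e; move: h.
by rewrite e addNr eqxx.
Qed.

End AddPower.

(** * The two cases of the rank computation *)

Section Main.
Variables (a0 a1 a2 : C).
Hypothesis l0 : ternary_linear a0 a1 a2 != 0.

Lemma ternary_form_point : exists L s, s != 0 /\ ternary_form a0 a1 a2 = s *: point_form L.
Proof.
by apply: point_of_form; apply: contraNneq l0 => /(congr1 val) /= ->.
Qed.

(** For the upper bound, l is added to an N-point decomposition of M. For the lower bound, at most N
    points would put L on power curves with al and be nonzero, so all its coordinates would be
    nonzero. *)
Lemma degenerate_rank lambda : a0 * a1 * a2 = 0 -> lambda != 0 ->
  waring_rank (3 * k) (f_ k a0 a1 a2 lambda) N.+1.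
Proof.
move=> aaa lambda0; have [L [s [s0 LE]]] := ternary_form_point.
have d0 : (0 < 3 * k)%N by lia.
apply: waring_rank_decomposition => // [|X decX].
  (* Since l has a zero coefficient, the orbit is taken through x0 + x1 + x2 instead. *)
  have ones : 1 * 1 * 1 != 0 :> C by rewrite !mulr1 oner_neq0.
  have [|L' [s' [s'0 L'E]]] := @point_of_form _ _ (ternary_form 1 1 1).
    apply/eqP => /(congr1 val) /= e; have [] := mcoeff_ternary_linear 1 1 1.
    by rewrite /= e mcoeff0 => /esym/eqP; rewrite oner_eq0.
  have [S [w [decS cardS _ _]]] := monomial_decomposition s'0 L'E ones.
  have decS' : waring_decomposition (3 * k) (monomial_form C k) S by exists w.
  have [Y [_ cardY decY _]] :=
    waring_decomposition_add d0 (ternary_form a0 a1 a2) lambda decS'.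
  by exists Y => //; rewrite -cardS.
rewrite ltnNge; apply/negP => cardX.
have [Y [b [decY b0 cardY LY _]]] := f_decomposition s0 LE lambda0 cardX decX.
have [al [be [al0 be0 onY]]] := decomposes_on_power_curves decY b0 cardY.
have [L0 L1 L2] := onY L LY.
have [e0 e1 e2] := ternary_form_coord LE.
have neq0 x al' : al' != 0 -> x ^+ k.+1 = al' * coord 0 L ^+ k.+1 -> x != 0.
  move=> al'0 xE; have : x ^+ k.+1 != 0 by rewrite xE mulf_neq0 // expf_neq0.
  by rewrite expf_eq0.
move/eqP: aaa; apply/negP; rewrite e0 e1 e2 !mulf_neq0 //.
  exact: neq0 L1.
exact: neq0 L2.
Qed.

(** Inclusion in every decomposition with at most N points gives both the rank and the uniqueness of
    the minimal decomposition. *)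
Lemma nondegenerate_minimal : a0 * a1 * a2 != 0 ->
  exists2 lambda0, lambda0 != 0 & forall lambda, lambda != 0 -> exists X,
    [/\ waring_decomposition (3 * k) (f_ k a0 a1 a2 lambda) X,
        #|` X| = (if lambda == lambda0 then N.-1 else N) &
        forall Y, waring_decomposition (3 * k) (f_ k a0 a1 a2 lambda) Y ->
          (#|` Y| <= N)%N -> X `<=` Y].
Proof.
move=> aaa; have [L [s [s0 LE]]] := ternary_form_point.
have [S [w [decS cardS w0 LS]]] := monomial_decomposition s0 LE aaa.
have sd0 : s ^+ (3 * k) != 0 by rewrite expf_neq0.
(* The left side is the coefficient of f at L relative to S; it vanishes for one lambda, which is
   nonzero because w L is. *)
have lambda0E lambda : (w L + lambda * s ^+ (3 * k) == 0) = (lambda == - (w L / s ^+ (3 * k))).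
  apply/eqP/eqP => [/eqP|->]; last by field.
  by rewrite addrC addr_eq0 => /eqP e; rewrite -mulNr -e mulfK.
set lambda0 := - _ in lambda0E.
exists lambda0; first by rewrite oppr_eq0 mulf_neq0 ?invr_eq0 ?w0.
move=> lambda lambda_neq0.
have fE : f_ k a0 a1 a2 lambda = \sum_(q <- S)
    (w q + (if q == L then lambda * s ^+ (3 * k) else 0)) *: repr_form q ^+ (3 * k).
  under eq_bigr => q _ do rewrite scalerDl.
  rewrite big_split /= sum_fset_single // decS -scalerA.
  by rewrite -(ternary_linear_power LE).
have low Y : waring_decomposition (3 * k) (f_ k a0 a1 a2 lambda) Y -> (#|` Y| <= N)%N ->
    (if lambda == lambda0 then S `\ L else S) `<=` Y.
  move=> decY cardY.
  have [X [b [decX b0 cardX LX [inX inL]]]] := f_decomposition s0 LE lambda_neq0 cardY decY.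
  have XS : X = S by apply: decomposes_unique_points decX decS b0 w0 cardX _ LX LS; rewrite cardS.
  have bw : b L = w L.
    by apply: (decomposes_unique_coefs _ decS); rewrite -?XS // XS cardS.
  rewrite bw lambda0E XS in inL inX.
  (* Points of S other than L always lie in Y; L does too whenever the two contributions at L do not
     cancel. *)
  case: ifPn => [_|ll]; apply/fsubsetP => p; first by rewrite !inE => /andP[pL /inX]; apply.
  by have [->|pL] := eqVneq p L; [move=> _; apply: inL | move/inX; apply].
case: eqP low => [ll|ll] low; [exists (S `\ L) | exists S]; split=> //.
- exists (fun q => w q + (if q == L then lambda * s ^+ (3 * k) else 0)).
  rewrite fE (big_fsetD1 L) //= eqxx (_ : w L + _ = 0) ?scale0r ?add0r //.
  by apply/eqP; rewrite lambda0E; apply/eqP.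
- by have := cardfsD1 L S; rewrite LS cardS => ->.
- by exists (fun q => w q + (if q == L then lambda * s ^+ (3 * k) else 0)).
Qed.

Lemma nondegenerate_rank : a0 * a1 * a2 != 0 ->
  exists2 lambda0, lambda0 != 0 & forall lambda, lambda != 0 ->
    waring_rank (3 * k) (f_ k a0 a1 a2 lambda) (if lambda == lambda0 then N.-1 else N) /\
    exists! X, minimal_waring_decomposition (3 * k) (f_ k a0 a1 a2 lambda) X.
Proof.
move=> aaa; have [lambda0 lambda00 minX] := nondegenerate_minimal aaa.
exists lambda0 => // lambda lambda_neq0; have [X [decX cardX minXY]] := minX _ lambda_neq0.
have cardXN : (#|` X| <= N)%N by rewrite cardX; case: ifP => // _; exact: leq_pred.
have rankX : waring_rank (3 * k) (f_ k a0 a1 a2 lambda) #|` X|.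
  apply: waring_rank_decomposition; [lia | by exists X |] => Y decY.
  have [/(minXY _ decY)/fsubset_leq_card //|/ltnW] := leqP #|` Y| N.
  exact: leq_trans.
split; first by rewrite -cardX.
exists X; split=> // Y [decY rankY]; have cardXY := waring_rank_unique rankX rankY.
by apply/eqP; rewrite eqEfcard minXY //= -cardXY.
Qed.

End Main.
End Degree.
End TernaryForms.

(** * The statement over the complex numbers *)

Local Open Scope complex_scope.
Unset Implicit Arguments.

Theorem theorem1p1 (R : realType) (k : nat) (a0 a1 a2 : R[i])
    (hk : (2 <= k)%N) (hl : ternary_linear a0 a1 a2 <> 0) :
  (a0 * a1 * a2 <> 0 ->
     (exists! lambda0 : R[i], lambda0 <> 0 /\
        forall lambda : R[i], lambda <> 0 ->
          (lambda = lambda0 ->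
             waring_rank (3 * k) (f_ k a0 a1 a2 lambda) ((k + 1) ^ 2 - 1)) /\
          (lambda <> lambda0 ->
             waring_rank (3 * k) (f_ k a0 a1 a2 lambda) ((k + 1) ^ 2))) /\
     (forall lambda : R[i], lambda <> 0 ->
        exists! X : {fset proj_point R[i] 2},
          minimal_waring_decomposition (3 * k) (f_ k a0 a1 a2 lambda) X)) /\
  (a0 * a1 * a2 = 0 ->
     forall lambda : R[i], lambda <> 0 ->
       waring_rank (3 * k) (f_ k a0 a1 a2 lambda) ((k + 1) ^ 2 + 1)).
Proof.
rewrite addn1 subn1 addn1; split=> [/eqP aaa|aaa lambda /eqP lambda_neq0]; last first.
  by apply: degenerate_rank => //; apply/eqP.
have /eqP l0 := hl.
have [lambda0 lambda00 rk] := nondegenerate_rank hk l0 aaa.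
split; last by move=> lambda /eqP /rk[].
exists lambda0; split.
  split; first exact/eqP.
  move=> lambda /eqP /rk[rank_f _]; split=> [e|/eqP/negPf ne].
    by move: rank_f; rewrite e eqxx.
  by move: rank_f; rewrite ne.
(* A second exceptional value would give the form at [lambda0] both ranks N - 1 and N. *)
move=> lambda1 [/eqP lambda10 rk1]; apply/eqP/negPn/negP => ne.
have [+ _] := rk _ lambda00; have [_ +] := rk1 lambda0 (elimN eqP lambda00).
rewrite eqxx => /(_ (elimN eqP ne)) r1 r2.
by have := waring_rank_unique r1 r2; rewrite expnS; lia.
Qed.
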